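(* Let $\Gamma\subset\mathbb R^n$ be a closed $d$-Ahlfors regular set with constant $C_0$, where $0<d<n-1$, and let $\Omega=\mathbb R^n\setminus\Gamma$. There exists a constant $c>0$, depending only on $C_0$, $n$ and $d$, such that the following holds. For every $\Lambda\ge 1$, every $r>0$, and all $x_1,x_2\in\Omega$ such that $\operatorname{dist}(x_i,\Gamma)\ge r$ for $i=1,2$ and $|x_1-x_2|\le \Lambda r$, there exist two points $y_1\in B(x_1,r/3)$ and $y_2\in B(x_2,r/3)$ such that $$\operatorname{dist}([y_1,y_2],\Gamma)\ \ge\ c\,\Lambda^{-d/(n-d-1)}\,r .$$
   Context: $\Gamma$ is $d$-Ahlfors regular with constant $C_0\ge1$ if $C_0^{-1}r^d\le \mathcal H^d(\Gamma\cap B(x,r))\le C_0r^d$ for all $x\in\Gamma$ and $r>0$, where $\mathcal H^d$ is the $d$-dimensional Hausdorff measure; $d$ need not be an integer. $[y_1,y_2]$ denotes the line segment from $y_1$ to $y_2$, and $B(x,r)$ the Euclidean ball. *)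

(* Defs.v *)
From HB Require Import structures.
From mathcomp Require Import all_boot all_order all_algebra.
From mathcomp Require Import all_classical all_reals all_analysis.
Set Implicit Arguments.
Unset Strict Implicit.
Unset Printing Implicit Defensive.
Import Order.TTheory GRing.Theory Num.Theory.
Import numFieldNormedType.Exports.
Local Open Scope classical_set_scope.
Local Open Scope ring_scope.

(* The library norm on 'rV[R]_n is the sup norm: it provides the topology used
   for [closed], which is the Euclidean one, but not the distances. *)
Definition enorm (R : realType) (n : nat) (x : 'rV[R]_n) : R :=
  Num.sqrt (\sum_(i < n) x 0 i ^+ 2).

Definition eball (R : realType) (n : nat) (x : 'rV[R]_n) (r : R) :
    set 'rV[R]_n :=
  [set y | enorm (y - x) < r].

(* Extended-real valued, so that the distance to the empty set is +oo. *)
Definition set_dist (R : realType) (n : nat) (A B : set 'rV[R]_n) : \bar R :=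
  ereal_inf [set (enorm (a - b))%:E | a in A & b in B].

(* 0 is adjoined so that the empty set has diameter 0 rather than -oo. *)
Definition diameter (R : realType) (n : nat) (A : set 'rV[R]_n) : \bar R :=
  ereal_sup (0%E |` [set (enorm (a - b))%:E | a in A & b in A]).

Definition segment (R : realType) (n : nat) (y1 y2 : 'rV[R]_n) :
    set 'rV[R]_n :=
  [set (1 - t) *: y1 + t *: y2 | t in `[0, 1]].

(* The Hausdorff measure is normalised without any dimensional constant: the
   weight of a covering set is its diameter to the power d. *)
Definition hausdorff_content (R : realType) (n : nat) (d delta : R)
    (A : set 'rV[R]_n) : \bar R :=
  ereal_inf [set (\sum_(0 <= k <oo) diameter (E k) `^ d)%E | E in
    [set E : (set 'rV[R]_n)^nat | A `<=` \bigcup_k E k /\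
       forall k, (diameter (E k) <= delta%:E)%E]].

(* The content is nonincreasing in delta: this supremum is the limit as delta
   tends to 0. *)
Definition hausdorff_measure (R : realType) (n : nat) (d : R)
    (A : set 'rV[R]_n) : \bar R :=
  ereal_sup [set hausdorff_content d delta A | delta in [set e : R | 0 < e]].

Definition ahlfors_regular (R : realType) (n : nat) (d C0 : R)
    (Gamma : set 'rV[R]_n) : Prop :=
  forall (x : 'rV[R]_n) (r : R), Gamma x -> 0 < r ->
    ((C0^-1 * r `^ d)%:E <= hausdorff_measure d (Gamma `&` eball x r))%E /\
    (hausdorff_measure d (Gamma `&` eball x r) <= (C0 * r `^ d)%:E)%E.

(* Main.v *)
(* Translate the segment [x1, x2] by the points y of a grid of spacing 12 rho,
   rho ~ Lambda^(-d/(n-d-1)) r, filling the part of the cube of size ~ r in the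
   coordinate hyperplane orthogonal to the largest coordinate of x2 - x1. If each
   translate came within rho of a point g_y of Gamma, then projecting along
   x2 - x1 onto that hyperplane would show the balls B(g_y, rho) to be separated,
   while they all lie in one ball of radius ~ Lambda r. As there are ~ (r/rho)^(n-1)
   of them, regularity gives (r/rho)^(n-1) rho^d <= C (Lambda r)^d, which fails
   when the constant in rho is small. *)
Require Import Defs.
From HB Require Import structures.
From mathcomp Require Import all_boot all_order all_algebra.
From mathcomp Require Import all_classical all_reals all_analysis.
From mathcomp Require Import ring lra.
Set Implicit Arguments.
Unset Strict Implicit.
Unset Printing Implicit Defensive.
Import Order.TTheory GRing.Theory Num.Theory.
Import numFieldNormedType.Exports.
Local Open Scope classical_set_scope.
Local Open Scope ring_scope.

(** * The Euclidean norm against coordinates *)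

Lemma abs_coord_le_enorm (R : realType) (n : nat) (x : 'rV[R]_n) (i : 'I_n) :
  `|x 0 i| <= enorm x.
Proof.
rewrite -sqrtr_sqr ler_sqrt; last by apply: sumr_ge0 => j _; exact: sqr_ge0.
rewrite (bigD1 i) //= lerDl; apply: sumr_ge0 => j _; exact: sqr_ge0.
Qed.

Lemma enorm_le (R : realType) (n : nat) (x : 'rV[R]_n) (b : R) :
  0 <= b -> (forall i, `|x 0 i| <= b) -> enorm x <= n%:R * b.
Proof.
move=> b_ge0 xb; rewrite -[leRHS]ger0_norm ?mulr_ge0// -sqrtr_sqr.
rewrite ler_sqrt ?sqr_ge0// (@le_trans _ _ (\sum_(i < n) b ^+ 2))//.
  by apply: ler_sum => i _; rewrite -(real_normK (num_real _)) lerXn2r ?nnegrE.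
rewrite sumr_const card_ord -[leLHS]mulr_natl exprMn ler_wpM2r ?sqr_ge0//.
by case: n {x xb} => [|n]; rewrite ?expr0n// ler_eXnr// ler1n.
Qed.

(** * Hausdorff measure of separated families *)

Lemma diameter_ge0 (R : realType) (n : nat) (E : set 'rV[R]_n) :
  (0 <= diameter E)%E.
Proof. by apply: ereal_sup_ubound; left. Qed.

Lemma diameter0 (R : realType) (n : nat) :
  diameter (set0 : set 'rV[R]_n) = 0%E.
Proof.
rewrite /diameter; set S := [set _ | _ in _ & _ in _].
have -> : S = set0 by apply/seteqP; split => // y [a []].
by rewrite setU0 ereal_sup1.
Qed.

Lemma hausdorff_content_separated (R : realType) (n : nat) (d delta : R)
    (T : finType) (A : T -> set 'rV[R]_n) (B : set 'rV[R]_n) :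
  d != 0 -> (forall t, A t `<=` B) ->
  (forall s t, s != t -> forall a b, A s a -> A t b -> delta < enorm (a - b)) ->
  (\sum_(t : T) hausdorff_content d delta (A t)
     <= hausdorff_content d delta B)%E.
Proof.
move=> d_neq0 AB sepA; apply: le_ereal_inf_tmp => _ [E [BE Edelta] <-].
pose meets t k := `[< E k `&` A t !=set0 >].
pose F t k := if meets t k then E k else set0.
have FE t k : (diameter (F t k) `^ d =
    if meets t k then diameter (E k) `^ d else 0)%E.
  by rewrite /F; case: ifP => // _; rewrite diameter0 poweR0r.
apply: (@le_trans _ _
    (\sum_(t : T) \sum_(0 <= k <oo) diameter (F t k) `^ d)%E).
  apply: lee_sum => t _; apply: ereal_inf_lbound; exists (F t) => //; split.
    move=> a Aa; have [k _ Eka] := BE _ (AB t _ Aa); exists k => //.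
    by rewrite /F ifT//; apply/asboolP; exists a.
  move=> k; rewrite /F; case: ifP => _; first exact: Edelta.
  by rewrite diameter0; exact: le_trans (diameter_ge0 (E k)) (Edelta k).
rewrite -nneseries_sum; last by move=> *; exact: poweR_ge0.
apply: lee_nneseries => [k _ _|k _].
  by apply: sume_ge0 => t _; exact: poweR_ge0.
have [[t tk]|nomeet] := pselect (exists t, meets t k); last first.
  rewrite big1 ?poweR_ge0// => t _; rewrite FE ifF//.
  by apply/negP => tk; apply: nomeet; exists t.
rewrite (bigD1 t)//= big1 => [|s st]; first by rewrite adde0 FE tk.
rewrite FE ifF//; apply/negP => /asboolP[a [Ea Asa]].
move/asboolP : tk => [b [Eb Atb]].
have := le_lt_trans (Edelta k) (sepA _ _ st _ _ Asa Atb : (_%:E < _%:E)%E).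
by apply/negP; rewrite -leNgt; apply: ereal_sup_ubound; right; exists a => //;
  exists b.
Qed.

Lemma hausdorff_content_le (R : realType) (n : nat) (d delta delta' : R)
    (A : set 'rV[R]_n) :
  delta' <= delta ->
  (hausdorff_content d delta A <= hausdorff_content d delta' A)%E.
Proof.
move=> le_delta; apply: le_ereal_inf_tmp => _ [E [AE Edelta] <-].
apply: ereal_inf_lbound; exists E => //; split => // k.
by apply: le_trans (Edelta k) _; rewrite lee_fin.
Qed.

(** The strict lower bound makes each [A t] have content above [L] at some scale; as [T] is finite,
    one scale below [eps] serves all [t], and contents add up there. *)
Lemma hausdorff_measure_separated (R : realType) (n : nat) (d eps L : R)
    (T : finType) (A : T -> set 'rV[R]_n) (B : set 'rV[R]_n) :
  d != 0 -> 0 < eps -> (forall t, A t `<=` B) ->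
  (forall s t, s != t -> forall a b, A s a -> A t b -> eps <= enorm (a - b)) ->
  (forall t, (L%:E < hausdorff_measure d (A t))%E) ->
  ((#|T|%:R * L)%:E <= hausdorff_measure d B)%E.
Proof.
move=> d_neq0 eps_gt0 AB sepA LA.
have /choice[del /all_and2[del_gt0 Ldel]] : forall t, exists e : R,
    0 < e /\ (L%:E < hausdorff_content d e (A t))%E.
  by move=> t; have [_ [e e0 <-] Le] := ereal_sup_gt (LA t); exists e.
(* The default [eps / 2] keeps [delta] strictly below [eps], even when [T] is empty. *)
pose delta := \big[Order.min/eps / 2]_(t : T) del t.
have delta_gt0 : 0 < delta.
  by apply: lt_bigmin => [|t _]; rewrite ?divr_gt0.
have delta_lt : delta < eps.
  by apply: le_lt_trans (bigmin_le_id _ _ _ _) _; rewrite gtr_pMr// invf_lt1 ?ltr1n.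
have le_content : (hausdorff_content d delta B <= hausdorff_measure d B)%E.
  by apply: ereal_sup_ubound; exists delta.
apply: le_trans le_content; apply: (@le_trans _ _ (\sum_(t : T) L%:E)%E).
  by rewrite sumEFin lee_fin sumr_const mulr_natl.
have sepA' s t : s != t -> forall a b, A s a -> A t b -> delta < enorm (a - b).
  by move=> st a b Aa Ab; apply: lt_le_trans delta_lt _; exact: sepA st _ _ Aa Ab.
apply: le_trans (hausdorff_content_separated d_neq0 AB sepA').
apply: lee_sum => t _; apply: (le_trans (ltW (Ldel t))).
exact/hausdorff_content_le/bigmin_le.
Qed.

Lemma ahlfors_regular_packing (R : realType) (n : nat) (d C0 eps rho K : R)
    (T : finType) (Gamma : set 'rV[R]_n) (g : T -> 'rV[R]_n) (z : 'rV[R]_n) :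
  d != 0 -> 0 < C0 -> ahlfors_regular d C0 Gamma ->
  0 < eps -> 0 < rho -> 0 < K -> Gamma z -> (forall t, Gamma (g t)) ->
  (forall t, eball (g t) rho `<=` eball z K) ->
  (forall s t, s != t -> forall a b, eball (g s) rho a -> eball (g t) rho b ->
     eps <= enorm (a - b)) ->
  #|T|%:R * (C0^-1 * rho `^ d / 2) <= C0 * K `^ d.
Proof.
move=> d_neq0 C0_gt0 regG eps_gt0 rho_gt0 K_gt0 Gz Gg sub sep.
rewrite -lee_fin; apply: le_trans (regG z K Gz K_gt0).2.
apply: (@hausdorff_measure_separated _ _ _ eps _ _
    (fun t => Gamma `&` eball (g t) rho)) => //.
- by move=> t; exact: setIS.
- by move=> s t st a b [_ sa] [_ tb]; exact: sep st _ _ sa tb.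
(* The factor [1 / 2] turns the lower bound of regularity into a strict one. *)
- move=> t; apply: lt_le_trans (regG _ _ (Gg t) rho_gt0).1.
  by rewrite lte_fin ltr_pdivrMr// ltr_pMr ?ltr1n// mulr_gt0 ?invr_gt0 ?powR_gt0.
Qed.

(* Dividing by [a] projects along the direction of the segment onto a coordinate
   hyperplane; the case [a = 0] needs no separate treatment since then
   [b = 0 = b / a]. *)
Lemma shear_separated (R : realType) (a b t t' y y' e e' f f' rho : R) :
  `|b| <= `|a| -> 12 * rho <= `|y - y'| ->
  `|e| <= 2 * rho -> `|e'| <= 2 * rho -> `|f| <= 2 * rho -> `|f'| <= 2 * rho ->
  `|t * a + e - (t' * a + e')| < 2 * rho ->
  2 * rho <= `|y + t * b + f - (y' + t' * b + f')|.
Proof.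
move=> ba yy' he he' hf hf' hp; rewrite leNgt; apply/negP => hq.
have [w w_le1 bE] : exists2 w, `|w| <= 1 & b = w * a.
  have [a0|a_neq0] := eqVneq a 0.
    move: ba; rewrite a0 normr0 normr_le0 => /eqP ->.
    by exists 0; rewrite ?normr0 ?mul0r.
  exists (b / a); last by rewrite divfK.
  by rewrite normf_div ler_pdivrMr ?normr_gt0// mul1r.
set p := t * a + e - (t' * a + e') in hp.
set q := y + t * b + f - (y' + t' * b + f') in hq.
(* The combination [q - w * p] cancels the terms in [t] and [t']. Both differences below are less
   than [(2 + 4) * rho], whence the spacing [12 * rho]. *)
have yE : y - y' = q - (f - f') - w * (p - (e - e')).
  by rewrite /p /q bE; ring.
have wp : `|w * (p - (e - e'))| <= `|p - (e - e')|.
  by rewrite normrM ler_piMl.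
have : `|p - (e - e')| < 6 * rho.
  apply: le_lt_trans (ler_normB _ _) _; have := ler_normB e e'; lra.
have : `|q - (f - f')| < 6 * rho.
  apply: le_lt_trans (ler_normB _ _) _; have := ler_normB f f'; lra.
have := ler_normB (q - (f - f')) (w * (p - (e - e'))).
by rewrite -yE; lra.
Qed.

(** For [p = n - 1], [tau = rho / r] solves [tau^(p - d) * A * Lambda^d = 1]: at this scale the
    total mass of the small balls balances that of the large one. *)
Lemma powR_threshold (R : realType) (p : nat) (d A Lambda : R) :
  d < p%:R -> 0 < A -> 0 < Lambda ->
  let tau := A `^ (- (p%:R - d)^-1) * Lambda `^ (- (d / (p%:R - d))) in
  tau `^ d = tau ^+ p * (A * Lambda `^ d).
Proof.
move=> dp A_gt0 L_gt0 tau.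
have e_neq0 : p%:R - d != 0 by rewrite subr_eq0 gt_eqF.
have tau_gt0 : 0 < tau by rewrite mulr_gt0 ?powR_gt0.
have tauE : tau `^ (p%:R - d) = (A * Lambda `^ d)^-1.
  rewrite powRM ?powR_ge0// -!powRrM !mulNr mulVf// divfK// powRN powRr1 ?ltW//.
  by rewrite powRN invfM.
have tau_neq0 : tau != 0 by rewrite gt_eqF.
rewrite -powR_mulrn ?ltW// -[in RHS](subrK d p%:R) powRD ?tau_neq0 ?implybT//.
by rewrite tauE mulrAC mulVf ?mul1r// mulf_neq0 ?gt_eqF ?powR_gt0.
Qed.

Lemma segment_close (R : realType) (n : nat) (u v : 'rV[R]_n)
    (Gamma : set 'rV[R]_n) (rho : R) :
  ~ (rho%:E <= set_dist (segment u v) Gamma)%E ->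
  exists t g, [/\ 0 <= t <= 1, Gamma g &
    enorm ((1 - t) *: u + t *: v - g) < rho].
Proof.
move=> /negP; rewrite -ltNge => /ereal_inf_lt[_ [_ [t t01 <-] [g Gg <-]] lt_rho].
by exists t, g; split=> //; move: t01; rewrite /= in_itv.
Qed.

Lemma norm_natB_ge1 (R : realType) (k l : nat) :
  k != l -> 1 <= `|k%:R - l%:R : R|.
Proof.
wlog kl : k l / (k < l)%N => [H|_].
  by rewrite neq_lt => /orP[] kl; last rewrite distrC; apply: H => //;
    rewrite ltn_eqF.
by rewrite distrC -natrB ?(ltnW kl)// ger0_norm// ler1n subn_gt0.
Qed.

(** The factor 72 keeps a grid of side [12 * m * rho] within [r / 6] of the origin; the bound with
    [C0] says that its [(m + 1)^p] points are too many for the packing inequality. *)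
Lemma tube_avoids (R : realType) (p : nat) (d C0 Lambda r rho : R) (m : nat)
    (Gamma : set 'rV[R]_p.+1) (x1 x2 : 'rV[R]_p.+1) :
  0 < d -> 0 < C0 -> ahlfors_regular d C0 Gamma -> 1 <= Lambda ->
  0 < rho -> rho <= r -> 72 * p.+1%:R * (m%:R * rho) <= r ->
  C0 * (7 * p.+1%:R * (Lambda * r)) `^ d
    < m.+1%:R ^+ p * (C0^-1 * rho `^ d / 2) ->
  enorm (x1 - x2) <= Lambda * r ->
  exists y : 'rV[R]_p.+1, enorm y < r / 3 /\
    (rho%:E <= set_dist (segment (x1 + y) (x2 + y)) Gamma)%E.
Proof.
move=> d_gt0 C0_gt0 regG L_ge1 rho_gt0 rho_le hm hcard hx.
have r_gt0 : 0 < r by apply: lt_le_trans rho_le.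
have Lr : r <= Lambda * r by rewrite ler_peMl// ltW.
have n_ge1 : 1 <= p.+1%:R :> R by rewrite ler1n.
pose v := x2 - x1.
have vL j : `|v 0 j| <= Lambda * r.
  apply: le_trans hx; rewrite -normrN (_ : - v 0 j = (x1 - x2) 0 j).
    exact: abs_coord_le_enorm.
  by rewrite !mxE opprB.
(* Maximality bounds by 1 the slopes of the projection along [v]. *)
pose i := [arg max_(j > ord0) `|v 0 j|]%O.
have vi j : `|v 0 j| <= `|v 0 i|.
  by rewrite /i; case: arg_maxP => // i' _ /(_ j); exact.
pose grid := {ffun 'I_p -> 'I_m.+1}.
pose y (k : grid) : 'rV[R]_p.+1 :=
  \row_j (if unlift i j is Some j' then 12 * rho * (k j')%:R else 0).
have yi k : y k 0 i = 0 by rewrite mxE unlift_none.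
have y_le k j : `|y k 0 j| <= 12 * (m%:R * rho).
  rewrite mxE; case: unliftP => [j' _|_]; last first.
    by rewrite normr0 !mulr_ge0// ltW.
  rewrite ger0_norm ?mulr_ge0// ?(ltW rho_gt0)// -mulrA ler_pM2l//.
  by rewrite mulrC ler_wpM2r ?(ltW rho_gt0)// ler_nat -ltnS.
have [[k hk]|none] := pselect (exists k,
    (rho%:E <= set_dist (segment (x1 + y k) (x2 + y k)) Gamma)%E).
  exists (y k); split=> //.
  apply: le_lt_trans (enorm_le _ (y_le k)) _; first by rewrite !mulr_ge0// ltW.
  lra.
have /choice[t /choice[g tg]] k : exists t g, [/\ 0 <= t <= 1, Gamma g &
    enorm ((1 - t) *: (x1 + y k) + t *: (x2 + y k) - g) < rho].
  by apply: segment_close => hk; apply: none; exists k.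
(* One [rho] from [a] to [g k], another from [g k] to the translated segment. *)
have near k a j : eball (g k) rho a ->
    `|a 0 j - (x1 0 j + y k 0 j + t k * v 0 j)| <= 2 * rho.
  rewrite /eball/= => /(le_lt_trans (abs_coord_le_enorm _ j)); rewrite !mxE => ha.
  have [_ _ /(le_lt_trans (abs_coord_le_enorm _ j))] := tg k.
  rewrite !mxE -/(y k 0 j) => hb.
  have := ler_normB (a 0 j - g k 0 j)
    ((1 - t k) * (x1 0 j + y k 0 j) + t k * (x2 0 j + y k 0 j) - g k 0 j).
  rewrite [X in `|X| <= _](_ : _ =
    a 0 j - (x1 0 j + y k 0 j + t k * (x2 0 j - x1 0 j))); last by ring.
  rewrite !mxE; lra.
have g_in k : eball (g k) rho (g k).
  by rewrite /eball/= subrr /enorm big1 ?sqrtr0// => j _; rewrite mxE expr0n.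
pose k0 : grid := [ffun=> ord0].
suff : #|grid|%:R * (C0^-1 * rho `^ d / 2)
    <= C0 * (7 * p.+1%:R * (Lambda * r)) `^ d.
  by rewrite card_ffun !card_ord natrX leNgt hcard.
have K_gt0 : 0 < 7 * p.+1%:R * (Lambda * r).
  by rewrite !mulr_gt0// (lt_le_trans _ L_ge1).
apply: (@ahlfors_regular_packing _ _ _ _ (2 * rho) _ _ _ Gamma g (g k0)) => //.
- by rewrite gt_eqF.
- by rewrite mulr_gt0.
- by have [] := tg k0.
- by move=> k; have [] := tg k.
- move=> k a ak; rewrite /eball/=.
  (* Two errors [2 * rho], two terms [t * v] and two grid shifts of at most [r / 6] add up to
     [(4 + 2 + 1/3) * (Lambda * r)] at most. *)
  have sup j : `|(a - g k0) 0 j| <= 13 / 2 * (Lambda * r).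
    have tv l : `|t l * v 0 j| <= Lambda * r.
      have [/andP[t0 t1] _ _] := tg l.
      by rewrite normrM ger0_norm//; apply: le_trans (vL j); rewrite ler_piMl.
    have yr l : `|y l 0 j| <= r / 6.
      by apply: le_trans (y_le l j) _; nra.
    have hk := near _ _ j ak; have hk0 := near _ _ j (g_in k0).
    move: hk hk0 (tv k) (tv k0) (yr k) (yr k0); rewrite !ler_norml !mxE.
    by move=> /andP[? ?] /andP[? ?] /andP[? ?] /andP[? ?] /andP[? ?] /andP[? ?];
      apply/andP; split; lra.
  apply: le_lt_trans (enorm_le _ sup) _; first by lra.
  by nra.
move=> k l kl a b ak bl.
have [j' kl'] : exists j', k j' != l j'.
  by apply/existsP; move: kl; apply: contraR => /existsPn kl; apply/eqP/ffunP => j;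
    apply/eqP/negPn.
pose j := lift i j'.
have yj : 12 * rho <= `|y k 0 j - y l 0 j|.
  rewrite !mxE liftK -mulrBr normrM ger0_norm ?mulr_ge0 ?(ltW rho_gt0)//.
  by rewrite ler_peMr ?mulr_ge0 ?(ltW rho_gt0)// norm_natB_ge1.
(* Either coordinate [i] already separates [a] from [b], or the shear argument separates them in
   coordinate [j], where [k] and [l] differ. *)
have [|ab] := ltP `|(a - b) 0 i| (2 * rho); last first.
  exact: le_trans ab (abs_coord_le_enorm _ _).
have ei := near _ _ i ak; have ej := near _ _ j ak.
have fi := near _ _ i bl; have fj := near _ _ j bl.
rewrite yi addr0 in ei fi.
move=> abi; apply: le_trans (abs_coord_le_enorm _ j).
have abE c : (a - b) 0 c =
    y k 0 c + t k * v 0 c + (a 0 c - (x1 0 c + y k 0 c + t k * v 0 c))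
    - (y l 0 c + t l * v 0 c + (b 0 c - (x1 0 c + y l 0 c + t l * v 0 c))).
  by rewrite [LHS]mxE [X in _ + X]mxE; ring.
rewrite abE; apply: (shear_separated (vi j) yj ei fi ej fj).
by move: abi; rewrite abE !yi !add0r !addr0.
Qed.

(** * Choice of the constants *)

Theorem lemma2p1 (R : realType) (n : nat) (d C0 : R)
    (d_gt0 : 0 < d) (d_lt : d < n%:R - 1) (C0_ge1 : 1 <= C0) :
  exists2 c : R, 0 < c &
    forall Gamma : set 'rV[R]_n, closed Gamma -> ahlfors_regular d C0 Gamma ->
    forall Lambda r : R, 1 <= Lambda -> 0 < r ->
    forall x1 x2 : 'rV[R]_n, (~` Gamma) x1 -> (~` Gamma) x2 ->
      (r%:E <= set_dist [set x1] Gamma)%E ->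
      (r%:E <= set_dist [set x2] Gamma)%E ->
      enorm (x1 - x2) <= Lambda * r ->
    exists y1 y2 : 'rV[R]_n,
      [/\ eball x1 (r / 3) y1, eball x2 (r / 3) y2 &
        ((c * Lambda `^ (- (d / (n%:R - d - 1))) * r)%:E
           <= set_dist (segment y1 y2) Gamma)%E].
Proof.
case: n d_lt => [|p] d_lt; first by exfalso; lra.
have dp : d < p%:R by move: d_lt; rewrite -natr1; lra.
have -> : p.+1%:R - d - 1 = p%:R - d :> R by rewrite -natr1; ring.
have C0_gt0 : 0 < C0 by lra.
pose N : R := p.+1%:R.
have N_ge1 : 1 <= N by rewrite ler1n.
(* Chosen so that the grid count beats the packing bound by a factor of at least 2; the other 2 in
   [4] offsets the halved mass. Also [A >= 1] gives [tau <= 1], that is [rho <= r]. *)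
pose A := 4 * C0 ^+ 2 * (72 * N) ^+ p * (7 * N) `^ d.
have A_ge1 : 1 <= A.
  rewrite !mulr_ege1 ?exprn_ege1//; try lra.
  by rewrite -[leLHS](powRr0 (7 * N)); apply: ler_powR; lra.
have A_gt0 : 0 < A by lra.
exists (A `^ (- (p%:R - d)^-1)) => [|Gamma _ regG L r L_ge1 r_gt0 x1 x2 _ _ _ _ hx].
  exact: powR_gt0.
have L_gt0 : 0 < L by lra.
have := powR_threshold dp A_gt0 L_gt0.
set tau := _ * L `^ _; rewrite /= => tauE.
have N_gt0 : 0 < N by lra.
have tau_gt0 : 0 < tau by rewrite mulr_gt0 ?powR_gt0.
have powN_le1 (a b : R) : 1 <= a -> 0 <= b -> a `^ (- b) <= 1.
  by move=> a1 b0; rewrite -[leRHS](powRr0 a); apply: ler_powR; rewrite ?oppr_le0.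
have tau_le1 : tau <= 1.
  have e_ge0 : 0 <= p%:R - d by lra.
  apply: mulr_ile1; rewrite ?powR_ge0//; apply: powN_le1 => //.
    by rewrite invr_ge0.
  by rewrite divr_ge0// ltW.
move: (tau) tauE tau_gt0 tau_le1 => {}tau tauE tau_gt0 tau_le1.
(* The largest [m] for which the grid fits; then [m + 1] exceeds [(72 * N * tau)^-1], which bounds
   the count from below. *)
pose m := Num.trunc (72 * N * tau)^-1.
have Ntau_gt0 : 0 < 72 * N * tau by rewrite !mulr_gt0.
have /andP[m_le m_gt] : m%:R <= (72 * N * tau)^-1 < m.+1%:R.
  by rewrite truncn_itv// invr_ge0 ltW.
have [||||y [y_lt hy]] := @tube_avoids R p d C0 L r (tau * r) m Gamma x1 x2
    d_gt0 C0_gt0 regG L_ge1 _ _ _ _ hx.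
- by rewrite mulr_gt0.
- by rewrite ler_piMl// ltW.
- have : m%:R * (72 * N * tau) <= 1 by rewrite -ler_pdivlMr// mul1r.
  rewrite -/N; move/(ler_wpM2r (ltW r_gt0)); lra.
- have hm : 1 <= (m.+1%:R * (72 * N * tau)) ^+ p.
    by rewrite exprn_ege1// -ler_pdivrMr// mul1r ltW.
  set X := (7 * N) `^ d * L `^ d * r `^ d.
  have X_gt0 : 0 < C0 * X by rewrite !mulr_gt0 ?powR_gt0 ?mulr_gt0.
  have -> : (7 * p.+1%:R * (L * r)) `^ d = X.
    have N7_ge0 : 0 <= 7 * N by lra.
    by rewrite (powRM _ N7_ge0) ?(powRM _ (ltW L_gt0)) ?mulr_ge0 ?ltW// mulrA.
  rewrite (powRM _ (ltW tau_gt0)) ?ltW// tauE.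
  have -> : m.+1%:R ^+ p * (C0^-1 * (tau ^+ p * (A * L `^ d) * r `^ d) / 2)
    = (m.+1%:R * (72 * N * tau)) ^+ p * (2 * (C0 * X)).
    by rewrite /A /X !exprMn; field; lra.
  by apply: lt_le_trans (ler_peMl _ hm); lra.
by exists (x1 + y), (x2 + y); split=> //; rewrite /eball /= addrAC subrr add0r.
Qed.
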